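(* Let $q$ and $r$ be two positive integers and $u_0$ be a non-negative integer. Let $(u_n)_{n \in \mathbb{N}}$ be the sequence of natural numbers whose general term is $u_n = r [n]_q + u_0$. Suppose that $\gcd(u_0, r) = \gcd(u_1, q) = 1$. Then, for any positive integers $n$ and $k$ such that $n \geq k$, the positive integer $\mathrm{lcm}\{u_k, u_{k+1}, \dots, u_n\}$ is a multiple of the rational number $$\frac{u_k u_{k+1} \cdots u_n}{[n-k]_q!}.$$
   Context: $\mathbb{N}$ is the set of non-negative integers. For $n \in \mathbb{N}$, $[n]_q := \frac{q^n - 1}{q - 1}$ if $q \neq 1$ and $[n]_1 := n$; $[n]_q! := [n]_q [n-1]_q \cdots [1]_q$, with $[0]_q! := 1$. An integer $a$ is said to be a multiple of a non-zero rational number $\rho$ if $a/\rho$ is an integer. *)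

(* Defs.v *)
From mathcomp Require Import all_boot all_order all_algebra.

Set Implicit Arguments.
Unset Strict Implicit.
Unset Printing Implicit Defensive.

Import Order.TTheory GRing.Theory Num.Theory.

(* [n]_q. For q > 0 the subtractions do not truncate and the division is exact
   ([qnumE]). *)
Definition qnum (q n : nat) : nat :=
  if q == 1 then n else (q ^ n - 1) %/ (q - 1).

Definition qfact (q n : nat) : nat := \prod_(1 <= i < n.+1) qnum q i.

Lemma qnumE (q n : nat) : 0 < q ->
  ((qnum q n)%:R =
    if q == 1%N then n%:R else (q%:R ^+ n - 1) / (q%:R - 1) :> rat)%R.
Proof.
move=> q0; rewrite /qnum; case: eqP => // /eqP q1.
have d : q - 1 %| q ^ n - 1 by rewrite !subn1 dvdn_pred_predX.
have nz : ((q - 1)%N%:R != 0 :> rat)%R.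
  by rewrite pnatr_eq0 -lt0n subn_gt0 ltn_neqAle eq_sym q1.
have -> : (q%:R - 1 = (q - 1)%N%:R :> rat)%R by rewrite natrB.
have -> : (q%:R ^+ n - 1 = (q ^ n - 1)%N%:R :> rat)%R.
  by rewrite natrB ?natrX // expn_gt0 q0.
by apply: (mulIf nz); rewrite divfK // -natrM divnK.
Qed.

(* The relation is only meaningful for rho != 0; the first conjunct excludes
   rho = 0, for which a / rho is 0 by the library's convention. *)
Definition multiple_of (a : int) (rho : rat) : Prop :=
  (rho != 0 /\ a%:~R / rho \is a Num.int)%R.

(* Main.v *)
Require Import Defs.
From mathcomp Require Import all_boot all_order all_algebra.

(** It suffices to compare [p]-parts for each prime [p]. Choose [i] in [k..n]
    with [u i] of largest [p]-adic valuation. For every other index [j], the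
    [p]-part of [u j] divides [gcdn (u i) (u j)]. As
    [u j - u i = r q^i [j - i]_q] and [u i] is coprime to [r] and [q], this gcd
    divides the [q]-number of [|j - i|]. Hence the [p]-part of the product
    divides [lcm * [i - k]_q! * [n - i]_q!], which divides [lcm * [n - k]_q!]
    because Gaussian binomial coefficients are integers. *)

(** The geometric sum treats [q = 1] uniformly and avoids truncated subtraction and division. *)
Lemma qnum_sum (q n : nat) : 0 < q -> qnum q n = \sum_(i < n) q ^ i.
Proof.
move=> q0; rewrite /qnum; case: eqP => [->|/eqP q1].
  by under eq_bigr do rewrite exp1n; rewrite sum1_card card_ord.
by rewrite !subn1 predn_exp mulKn // -subn1 subn_gt0 ltn_neqAle eq_sym q1.
Qed.

Lemma qnumD (q a b : nat) : 0 < q ->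
  qnum q (a + b) = qnum q a + q ^ a * qnum q b.
Proof.
move=> q0; rewrite !qnum_sum // big_split_ord /= big_distrr /=.
by congr (_ + _); apply: eq_bigr => i _; rewrite expnD.
Qed.

Lemma qnum_gt0 (q n : nat) : 0 < q -> 0 < n -> 0 < qnum q n.
Proof.
by case: n => // n q0 _; rewrite qnum_sum // big_ord_recl expn0.
Qed.

Lemma qfactS (q n : nat) : qfact q n.+1 = qfact q n * qnum q n.+1.
Proof. by rewrite /qfact big_nat_recr. Qed.

Lemma qfact_gt0 (q n : nat) : 0 < q -> 0 < qfact q n.
Proof.
move=> q0; elim: n => [|n IH]; first by rewrite /qfact big_geq.
by rewrite qfactS muln_gt0 IH qnum_gt0.
Qed.

(** Integrality of the Gaussian binomials, by the q-Pascal rule: [qnumD] splits the last factor of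
    [qfact q (a.+1 + b.+1)] in two, and each resulting term falls to one of the two nested induction
    hypotheses. *)
Lemma dvdn_qfactD (q a b : nat) : 0 < q ->
  qfact q a * qfact q b %| qfact q (a + b).
Proof.
move=> q0; have qfact0 : qfact q 0 = 1 by rewrite /qfact big_geq.
elim: a b => [|a IHa] b; first by rewrite qfact0 mul1n.
elim: b => [|b IHb]; first by rewrite qfact0 muln1 addn0.
have -> : qfact q (a.+1 + b.+1) =
    qfact q (a + b.+1) * qnum q a.+1 + qfact q (a.+1 + b) * (q ^ a.+1 * qnum q b.+1).
  by rewrite addSn qfactS -addSn qnumD // mulnDr addSnnS.
rewrite dvdn_add //; first by rewrite qfactS mulnAC dvdn_mul.
by rewrite [qfact q b.+1]qfactS mulnA dvdn_mul // dvdn_mull.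
Qed.

Lemma dvdn_prod_nat (m n : nat) (F G : nat -> nat) :
  (forall i, m <= i < n -> F i %| G i) ->
  \prod_(m <= i < n) F i %| \prod_(m <= i < n) G i.
Proof.
move=> FG; rewrite [X in X %| _]big_nat [X in _ %| X]big_nat.
by elim/big_ind2: _ => // *; apply: dvdn_mul.
Qed.

Lemma partn_prod_nat (pi : nat_pred) (m n : nat) (F : nat -> nat) :
  (forall i, m <= i < n -> 0 < F i) ->
  (\prod_(m <= i < n) F i)`_pi = \prod_(m <= i < n) (F i)`_pi.
Proof.
move=> F0; rewrite [in LHS]big_nat [in RHS]big_nat.
(* Positivity is carried through the induction because [partnM] needs both factors positive. *)
suff [] : 0 < \prod_(m <= i < n | m <= i < n) F i /\
  (\prod_(m <= i < n | m <= i < n) F i)`_pi =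
    \prod_(m <= i < n | m <= i < n) (F i)`_pi by [].
elim/big_rec2: _ => [|i x y /F0 Fi [y0 yx]]; first by rewrite partn1.
by rewrite muln_gt0 Fi y0 partnM // yx.
Qed.

Lemma dvdn_biglcm_nat (m n i : nat) (F : nat -> nat) :
  m <= i < n -> F i %| \big[lcmn/1]_(m <= i < n) F i.
Proof.
case/andP=> mi lt_in; rewrite big_geq_mkord.
exact: (biglcmn_sup (Ordinal lt_in)).
Qed.

Lemma exists_max_logn (p k n : nat) (u : nat -> nat) : k <= n ->
  exists2 i, k <= i <= n & forall j, k <= j <= n -> logn p (u j) <= logn p (u i).
Proof.
move=> kn.
case: (@arg_maxnP _ (ord_max : 'I_n.+1) (fun i : 'I_n.+1 => k <= i)
         (fun i : 'I_n.+1 => logn p (u i)) kn) => i ki imax.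
exists i => [|j /andP[kj jn]]; first by rewrite ki -ltnS ltn_ord.
by have := imax (Ordinal (jn : j < n.+1)) kj.
Qed.

(** With [f] abstract, the argument uses only the gcd bound and the integrality of the binomials
    built from [f]. *)
Lemma prod_dvdn_lcm (u f : nat -> nat) (k n : nat) : k <= n ->
  (forall i, k <= i <= n -> 0 < u i) ->
  (forall i j, k <= i -> i < j -> j <= n -> gcdn (u i) (u j) %| f (j - i)) ->
  (forall a b, \prod_(1 <= d < a.+1) f d * \prod_(1 <= d < b.+1) f d
     %| \prod_(1 <= d < (a + b).+1) f d) ->
  \prod_(k <= i < n.+1) u i
    %| \big[lcmn/1]_(k <= i < n.+1) u i * \prod_(1 <= d < (n - k).+1) f d.
Proof.
move=> kn u0 uf fD.
have P0 : 0 < \prod_(k <= i < n.+1) u i.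
  by rewrite big_nat; apply: prodn_cond_gt0 => i /u0.
apply/(dvdn_partP _ P0) => p _; rewrite partn_prod_nat //.
have [i kin imax] := exists_max_logn p k n u kn.
have /andP[ki i_n] := kin.
have part_i j : k <= j <= n -> (u j)`_p %| gcdn (u i) (u j).
  move=> kjn; rewrite dvdn_gcd dvdn_part andbT.
  apply: dvdn_trans (dvdn_part p (u i)).
  by rewrite !p_part dvdn_exp2l // imax.
have low : \prod_(k <= j < i) (u j)`_p %| \prod_(1 <= d < (i - k).+1) f d.
  (* Reversing the product lists the indices below [i] by their distance to [i]: the factor at
     [i - j.+1] is matched with [f j.+1]. *)
  rewrite big_add1 /= big_nat_rev /= -{1}[k]add0n big_addn.
  apply: dvdn_prod_nat => j /andP[_ ji].
  have jki : j + k < i by rewrite addnC -ltn_subRL.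
  have -> : k + i - (j + k).+1 = i - j.+1 by rewrite -addSn [j.+1 + k]addnC subnDl.
  have ji' : j < i := leq_ltn_trans (leq_addr k j) jki.
  have kij : k <= i - j.+1 by rewrite leq_subRL // addSn.
  have ij : i - j.+1 < i by rewrite ltn_subrL (leq_ltn_trans _ ji').
  apply: dvdn_trans (part_i _ _) _; first by rewrite kij (leq_trans (ltnW ij)).
  by rewrite gcdnC -[in f _](subKn ji') uf.
have high : \prod_(i.+1 <= j < n.+1) (u j)`_p %| \prod_(1 <= d < (n - i).+1) f d.
  (* Shifting by [i] matches the factor at [d + i] with [f d]. *)
  rewrite -{1}[i.+1]add1n big_addn subSn //.
  apply: dvdn_prod_nat => d /andP[d0 dn].
  have din : d + i <= n by rewrite -(subnK i_n) leq_add2r.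
  have kdi : k <= d + i by rewrite (leq_trans ki) ?leq_addl.
  apply: dvdn_trans (part_i _ _) _; first by rewrite kdi.
  by rewrite -[d in f d](addnK i) uf // -[X in X < _]add0n ltn_add2r.
(* The factor at [i] is absorbed by the lcm, the factors on either side by the product of the
   [f d]. *)
rewrite (@big_cat_nat _ _ _ i) ?leqW //= [X in _ * X]big_ltn // mulnCA.
apply: dvdn_mul.
  by apply: dvdn_trans (dvdn_part _ _) _; apply: dvdn_biglcm_nat; rewrite ki.
apply: dvdn_trans (dvdn_mul low high) _.
have -> : n - k = (i - k) + (n - i) by rewrite addnC addnBA // subnK.
exact: fD.
Qed.

Section QArithmeticProgression.

Variables (q r u0 : nat) (u : nat -> nat).
Hypotheses (q_gt0 : 0 < q) (uE : forall n, u n = r * qnum q n + u0).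

Lemma coprime_u_r (n : nat) : coprime (u 0) r -> coprime (u n) r.
Proof. by rewrite ![coprime _ r]coprime_sym /coprime !uE ![r * _]mulnC !gcdnMDl. Qed.

(** Since [qnum q n.+1 = 1 + q * qnum q n], every term of positive index is congruent to [u 1]
    modulo [q]. *)
Lemma coprime_u_q (n : nat) : coprime (u 1) q -> 0 < n -> coprime (u n) q.
Proof.
case: n => // n; have -> : u n.+1 = r * qnum q n * q + u 1.
  by rewrite !uE -add1n qnumD // expn1 mulnDr addnA [q * _]mulnC mulnA [_ * q + _]addnC.
by rewrite ![coprime _ q]coprime_sym /coprime gcdnMDl.
Qed.

Lemma gcdn_u (i j : nat) : coprime (u 0) r -> coprime (u 1) q ->
  0 < i -> i < j -> gcdn (u i) (u j) %| qnum q (j - i).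
Proof.
move=> u0r u1q i0 ij.
have ujE : u j = u i + r * q ^ i * qnum q (j - i).
  by rewrite !uE -{1}(subnKC (ltnW ij)) qnumD // mulnDr addnAC mulnA.
have cop : coprime (gcdn (u i) (u j)) (r * q ^ i).
  apply: coprime_dvdl (dvdn_gcdl _ _) _.
  by rewrite coprimeMr coprime_u_r // coprimeXr // coprime_u_q.
rewrite -(Gauss_dvdr _ cop) -(dvdn_addr _ (dvdn_gcdl (u i) (u j))) -ujE.
exact: dvdn_gcdr.
Qed.

End QArithmeticProgression.

Theorem theorem1p1 (q r u0 : nat) (u : nat -> nat)
    (hq : 0 < q) (hr : 0 < r)
    (hu : forall n : nat, u n = r * qnum q n + u0)
    (hu0r : gcdn (u 0) r = 1) (hu1q : gcdn (u 1) q = 1)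
    (n k : nat) (hn : 0 < n) (hk : 0 < k) (hkn : k <= n) :
  multiple_of (Posz (\big[lcmn/1%N]_(k <= i < n.+1) u i))
    ((\prod_(k <= i < n.+1) u i)%N%:R / (qfact q (n - k)%N)%:R)%R.
Proof.
have u_gt0 i : k <= i <= n -> 0 < u i.
  case/andP=> ki _; rewrite hu addn_gt0 muln_gt0 hr qnum_gt0 //.
  exact: leq_trans ki.
have prod_gt0 : 0 < \prod_(k <= i < n.+1) u i.
  by rewrite big_nat; apply: prodn_cond_gt0 => i /u_gt0.
have fact_gt0 := qfact_gt0 q (n - k) hq.
have dvd : \prod_(k <= i < n.+1) u i
    %| \big[lcmn/1]_(k <= i < n.+1) u i * qfact q (n - k).
  apply: prod_dvdn_lcm => // [i j ki ij _|a b]; last exact: dvdn_qfactD.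
  apply: (gcdn_u q r u0 u hq hu) => //; [exact/eqP | exact/eqP | exact: leq_trans ki].
split.
  by rewrite GRing.mulf_neq0 ?GRing.invr_eq0 ?Num.Theory.pnatr_eq0 -?lt0n.
(* Inverting the quotient moves [qfact] to the numerator, so that integrality becomes the
   divisibility [dvd]. *)
rewrite GRing.invf_div GRing.mulrA -[_%:~R%R]/(_%:R)%R -GRing.natrM.
exact: (@Qint_dvdz (Posz _) (Posz _)).
Qed.
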